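(* Let $d\ge 1$ be an integer, $K=d+3$, and let $\overline{\gamma}=(\gamma_1,\dots,\gamma_d)\in\mathbb{R}^d$ satisfy condition (KM). Let $X$ be $\mathbb{R}^2$ with a norm $\|\cdot\|_X$ whose closed unit ball $BX$ is a symmetric convex polygon with $2K$ sides such that the slopes of its $K$ pairwise non-parallel sides are $\gamma_1,\dots,\gamma_d,0,1,\infty$. Then there is a compact set $E\subset X$ of Hausdorff dimension $2$ such that the one-dimensional Lebesgue measure of $\Delta_X(E)$ is $0$.
   Context: Slopes are with respect to the standard coordinates: the slope of a non-degenerate segment on the line $u_1x_1+u_2x_2+u_0=0$ is $-u_1/u_2$ (and $\infty$ if $u_2=0$). For a positive integer $L$ let $\mathcal{L}(L)=\{\overline{l}=(l_1,\dots,l_d)\in\mathbb{Z}^d: 0\le l_k<L \text{ for } k=1,\dots,d\}$. A vector $\overline{\gamma}\in\mathbb{R}^d$ satisfies condition (KM) if for every positive integer $L$ and every $\varepsilon>0$, $$\inf\Big|\sum_{\overline{l}\in\mathcal{L}(L)} n_{\overline{l}}\,\gamma_1^{l_1}\cdots\gamma_d^{l_d}\Big|\cdot\Big(\max_{\overline{l}\in\mathcal{L}(L)}|n_{\overline{l}}|\Big)^{(1+\varepsilon)L^d}>0,$$ the infimum being over all nonzero integer vectors $(n_{\overline{l}})_{\overline{l}\in\mathcal{L}(L)}$. For $E\subset X$, $\Delta_X(E)=\{\|x-x'\|_X: x,x'\in E\}$. *)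

(* Defs.v *)
From HB Require Import structures.
From mathcomp Require Import all_boot all_order all_algebra.
From mathcomp Require Import all_classical all_reals all_analysis.
Set Implicit Arguments. Unset Strict Implicit. Unset Printing Implicit Defensive.
Import Order.TTheory GRing.Theory Num.Theory.
Import numFieldNormedType.Exports.
Local Open Scope classical_set_scope.
Local Open Scope ring_scope.

Section Defs.
Variable R : realType.
Notation P2 := (R * R)%type.

Definition psub (x y : P2) : P2 := (x.1 - y.1, x.2 - y.2).

Definition is_norm2 (nX : P2 -> R) : Prop :=
  [/\ forall x, nX x = 0 <-> x = (0, 0),
      forall (a : R) x, nX (a * x.1, a * x.2) = `|a| * nX x &
      forall x y, nX (x.1 + y.1, x.2 + y.2) <= nX x + nX y].

Definition unit_ball (nX : P2 -> R) : set P2 := [set x | nX x <= 1].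

Definition on_line (l : P2 * R) (x : P2) : Prop :=
  l.1.1 * x.1 + l.1.2 * x.2 + l.2 = 0.

Definition supporting_line (B : set P2) (l : P2 * R) : Prop :=
  l.1 != (0, 0) /\ forall x, B x -> l.1.1 * x.1 + l.1.2 * x.2 + l.2 <= 0.

Definition side_on_line (B : set P2) (S : set P2) (l : P2 * R) : Prop :=
  [/\ supporting_line B l, S = B `&` on_line l &
      exists x y, [/\ S x, S y & x <> y]].

Definition is_side (B : set P2) (S : set P2) : Prop :=
  exists l, side_on_line B S l.

(* slope of the line u1 x1 + u2 x2 + u0 = 0 : -u1/u2, None standing for oo *)
Definition line_slope (l : P2 * R) : option R :=
  if l.1.2 == 0 then None else Some (- l.1.1 / l.1.2).

Definition side_has_slope (B S : set P2) (m : option R) : Prop :=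
  exists l, side_on_line B S l /\ line_slope l = m.

Definition convex2 (B : set P2) : Prop :=
  forall x y (t : R), B x -> B y -> 0 <= t <= 1 ->
    B ((1 - t) * x.1 + t * y.1, (1 - t) * x.2 + t * y.2).

Definition symmetric2 (B : set P2) : Prop :=
  forall x, B x -> B (- x.1, - x.2).

Definition polyhedral2 (B : set P2) : Prop :=
  exists (m : nat) (h : 'I_m -> P2 * R),
    B = [set x | forall i, (h i).1.1 * x.1 + (h i).1.2 * x.2 <= (h i).2].

Definition sym_convex_polygon (B : set P2) (n : nat) : Prop :=
  [/\ symmetric2 B, convex2 B, compact B, polyhedral2 B &
      exists S : 'I_n -> set P2,
        injective S /\ (forall i, is_side B (S i)) /\
        (forall T, is_side B T -> exists i, T = S i)].

Definition prescribed_slope (d : nat) (g : 'I_d -> R) (k : 'I_(d + 3)) :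
    option R :=
  match ltnP k d with
  | LtnNotGeq Hk => Some (g (Ordinal Hk))
  | _ => if val k == d then Some 0
         else if val k == d.+1 then Some 1 else None
  end.

Definition KM (d : nat) (g : 'I_d -> R) : Prop :=
  forall (L : nat) (eps : R), (0 < L)%N -> 0 < eps ->
    exists c : R, 0 < c /\
      forall n : {ffun {ffun 'I_d -> 'I_L} -> int},
        (exists l, n l != 0) ->
        c <= `| \sum_(l : {ffun 'I_d -> 'I_L})
                   (n l)%:~R * \prod_(k < d) g k ^+ (l k) |
             * (\big[Num.max/0]_(l : {ffun 'I_d -> 'I_L}) `|(n l)%:~R|)
                 `^ ((1 + eps) * (L ^ d)%:R).

Definition diamX (nX : P2 -> R) (U : set P2) : \bar R :=
  ereal_sup [set (nX (psub x y))%:E | x in U & y in U].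

Definition hweight (nX : P2 -> R) (s : R) (U : set P2) : \bar R :=
  if U == set0 then 0%E else ((fine (diamX nX U)) `^ s)%:E.

Definition hcontent (nX : P2 -> R) (s delta : R) (E : set P2) : \bar R :=
  ereal_inf [set (\sum_(i <oo) hweight nX s (U i))%E |
             U in [set U : nat -> set P2 |
                   E `<=` \bigcup_i U i /\
                   forall i, (diamX nX (U i) <= delta%:E)%E]].

Definition hausdorff_measure (nX : P2 -> R) (s : R) (E : set P2) : \bar R :=
  ereal_sup [set hcontent nX s delta E | delta in [set delta : R | 0 < delta]].

Definition hausdorff_dim (nX : P2 -> R) (E : set P2) : \bar R :=
  ereal_inf [set s%:E | s in [set s : R | 0 <= s /\
                                hausdorff_measure nX s E = 0%E]].

Definition DeltaX (nX : P2 -> R) (E : set P2) : set R :=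
  [set nX (psub x y) | x in E & y in E].

End Defs.

(* Main.v *)
(** The distance [nX z] is always one of finitely many linear forms [dot b z],
    so it suffices to find a planar set [E] of dimension 2 on which every form
    [b] has a null difference set.  Scales are chosen to decrease extremely
    fast, and at scale [n] only one form [b] (each one infinitely often) is
    forced to lie within [h / n], up to a constant, of the lattice [h Z].
    Differences then lie near [h Z] for infinitely many [n], hence form a null
    set, while passing to these thin strips costs at scale [n] a factor of
    order [n] only, which is negligible against the ratio of consecutive
    scales, so the dimension stays 2.  For the lower bound, a cover of [E] by
    too small a family is defeated by choosing nested squares one at a time,
    averaging over the children of the current square.  This is Falconer's
    construction for polyhedral norms. *)

Require Import Defs.
From HB Require Import structures.
From mathcomp Require Import all_boot all_order all_algebra.
From mathcomp Require Import all_classical all_reals all_analysis.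
From mathcomp Require Import ring lra.
Import Order.TTheory GRing.Theory Num.Theory.
Import numFieldNormedType.Exports.
Local Open Scope classical_set_scope.
Local Open Scope ring_scope.
Set Implicit Arguments.
Unset Strict Implicit.
Unset Printing Implicit Defensive.

(** * Children of a square *)

Section Geometry.
Variable R : realType.
Implicit Types (a p x y : R * R) (U : set (R * R)).

Definition dot a x : R := a.1 * x.1 + a.2 * x.2.

Definition square p (r : R) : set (R * R) :=
  [set x | p.1 <= x.1 <= p.1 + r /\ p.2 <= x.2 <= p.2 + r].

Definition strips (h e : R) : set R :=
  [set t | exists k : int, `|t - k%:~R * h| <= e].

Definition supdiam_le U (rho : R) : Prop :=
  forall x y, U x -> U y -> `|x.1 - y.1| <= rho /\ `|x.2 - y.2| <= rho.

Definition meets_square U p (r : R) : bool := `[< square p r `&` U !=set0 >].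

(** Moving by [h] along the axis on which the lines are stacked changes [dot a] by [pivot a * h].
    Its sign is harmless, since [strips] runs over all integers. *)
Definition pivot a : R := if a.2 == 0 then a.1 else a.2.

Definition l1norm a : R := `|a.1| + `|a.2|.

Definition swap2 x : R * R := (x.2, x.1).

Lemma modn_inj_le (i j L : nat) : (i <= j + L)%N -> (j <= i + L)%N ->
  (i %% L.+1 = j %% L.+1)%N -> i = j.
Proof.
wlog ij : i j / (i <= j)%N => [H h1 h2 h3|].
  by case/orP: (leq_total i j) => ij; [|apply: esym]; apply: H.
move=> _ jL /eqP; rewrite eq_sym eqn_mod_dvd// => dv.
have : (j - i <= L)%N by rewrite leq_subLR.
case: (posnP (j - i)) => [/eqP|ji_gt0 jiL].
  by rewrite subn_eq0 => ji _; apply/eqP; rewrite eqn_leq ij.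
by have := dvdn_leq ji_gt0 dv; rewrite ltnNge jiL.
Qed.

Lemma close_ord (i j : nat) (L u c : R) : 0 < c -> 
  `|i%:R * c - j%:R * c| <= u -> u <= L * c -> (i <= j + Num.truncn L)%N.
Proof.
move=> c0 ijc uLc.
have h : i%:R - j%:R <= L.
  rewrite -(ler_pM2r c0) mulrBl (le_trans (ler_norm _))//.
  exact: le_trans ijc uLc.
case: (leqP i j) => [ij|/ltnW ji]; first exact: leq_trans ij (leq_addr _ _).
rewrite -leq_subLR truncn_ge_nat ?natrB//.
by rewrite (le_trans _ h)// subr_ge0 ler_nat.
Qed.

(* A pair [(j, l)] of a set that is narrow in both directions is determined by
   the residues of [j] and [l] modulo one plus the width. *)
Lemma card_narrow (P T : nat) (S : {set 'I_P * 'I_T}) (L : nat) :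
  (forall u v, u \in S -> v \in S -> (u.1 <= v.1 + L)%N) ->
  (forall u v, u \in S -> v \in S -> u.1 = v.1 -> (u.2 <= v.2 + L)%N) ->
  (#|S| <= L.+1 ^ 2)%N.
Proof.
move=> h1 h2.
pose f (u : 'I_P * 'I_T) : 'I_L.+1 * 'I_L.+1 :=
  (inord (u.1 %% L.+1)%N, inord (u.2 %% L.+1)%N).
have fI : {in S &, injective f}.
  move=> [u1 u2] [v1 v2] uS vS [] /(congr1 val)/=.
  rewrite !inordK ?ltn_mod// => e1 /(congr1 val)/=.
  rewrite !inordK ?ltn_mod// => e2.
  have e : u1 = v1.
    by apply/val_inj/(modn_inj_le (h1 _ _ uS vS) (h1 _ _ vS uS) e1).
  subst v1; congr pair; apply/val_inj.
  exact: (modn_inj_le (h2 _ _ uS vS erefl) (h2 _ _ vS uS erefl) e2).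
rewrite -(card_in_imset fI) (leq_trans (max_card _))//.
by rewrite card_prod card_ord mulnn.
Qed.

Lemma meets_square_close U p q (r rho : R) : supdiam_le U rho -> meets_square U p r ->
  meets_square U q r -> `|p.1 - q.1| <= r + rho /\ `|p.2 - q.2| <= r + rho.
Proof.
move=> dU /asboolP[x [[/andP[xa xb] /andP[xc xd]] Ux]].
move=> /asboolP[y [[/andP[ya yb] /andP[yc yd]] Uy]].
have [] := dU _ _ Ux Uy; rewrite !ler_norml => /andP[? ?] /andP[? ?].
by split; apply/andP; split; lra.
Qed.

Section Children.
Variables (a p : R * R) (r : R) (T W : nat).
Let side : R := r / (W * T.+1)%:R.

(** There are [W * T.+1] columns of [T] squares, so about one in [W] of the grid cells of mesh
    [side] is kept. The count in the last clause is that of the full grid. *)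
Definition good_children (c : 'I_(W * T.+1) * 'I_T -> R * R) : Prop :=
  [/\ forall i, square (c i) side `<=` square p r,
      forall i x, square (c i) side x ->
        strips (pivot a * (r / T.+1%:R)) (l1norm a * side) (dot a x) &
      forall U rho, 0 <= rho -> supdiam_le U rho ->
        #|[set i | meets_square U (c i) side]%SET|%:R <= (2 + rho / side) ^+ 2].

(* One child per column of width [side] and per line [dot a x = k * a.2 * h];
   consecutive lines are at vertical distance [h]. *)
Lemma children_nonvertical : a.2 != 0 -> 0 < r -> (0 < W)%N ->
  exists c, good_children c.
Proof.
move=> b0 r0 W0.
have WT0 : 0 < (W * T.+1)%:R :> R by rewrite ltr0n muln_gt0 W0.
have s0 : 0 < side by rewrite divr_gt0.
pose h := r / T.+1%:R.
have h0 : 0 < h by rewrite divr_gt0.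
have sh : side <= h.
  by rewrite ler_pM2l// lef_pV2 ?posrE// ler_nat leq_pmull.
pose X (j : nat) := p.1 + j%:R * side.
(* [Y j] is the height of the first line at or above [p.2] over [X j]. It overshoots by at most [h],
   which is why a column holds [T] squares and not [T.+1]. *)
pose k (j : nat) := Num.ceil ((p.2 + a.1 / a.2 * X j) / h).
pose Y j := (k j)%:~R * h - a.1 / a.2 * X j.
have Y1 j : p.2 <= Y j.
  by rewrite lerBrDr -ler_pdivrMr// ceil_ge.
have Y2 j : Y j <= p.2 + h.
  have := ceilB1_lt ((p.2 + a.1 / a.2 * X j) / h).
  rewrite -/(k j) intrB => /ltW; rewrite -(ler_pM2r h0) mulrBl mul1r.
  by rewrite divfK ?gt_eqF// /Y; lra.
have hT : h * T%:R + h = r.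
  by rewrite -{2}(mulr1 h) -mulrDr natr1 divfK.
have sP : side * (W * T.+1)%:R = r by rewrite divfK// gt_eqF.
pose c (i : 'I_(W * T.+1) * 'I_T) := (X i.1, Y i.1 + i.2%:R * h).
exists c; split => [[j l]|[j l] x|U rho rho0 dU].
- move=> x [/= /andP[xa xb] /andP[xc xd]].
  have jX : X j + side <= p.1 + r.
    rewrite -addrA lerD2l -sP mulrC -[X in _ + X]mulr1 -mulrDr natr1.
    by rewrite ler_pM2l// ler_nat.
  have lY : l%:R * h + side <= r.
    rewrite -hT mulrC lerD// ler_pM2l// ler_nat; exact: ltnW.
  have lY' : l%:R * h + h <= h * T%:R.
    by rewrite mulrC -{2}[h]mulr1 -mulrDr natr1 ler_pM2l// ler_nat.
  have := Y1 j; have := Y2 j => y2 y1.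
  have X1 : p.1 <= X j by rewrite lerDl mulr_ge0// ltW.
  have lh0 : 0 <= l%:R * h by rewrite mulr_ge0// ltW.
  by split; apply/andP; split; lra.
- move=> [/= /andP[xa xb] /andP[xc xd]].
  exists (k j + l)%R; rewrite /pivot (negbTE b0) -/h.
  have -> : dot a x - (k j + l)%:~R * (a.2 * h) =
      a.1 * (x.1 - X j) + a.2 * (x.2 - (Y j + l%:R * h)).
    rewrite /dot /Y intrD -pmulrn; field.
    exact: b0.
  rewrite (le_trans (ler_normD _ _))// !normrM /l1norm mulrDl.
  by rewrite lerD// ler_wpM2l// ger0_norm; lra.
(* Corners of squares met by [U] differ by at most [side + rho] in each coordinate, hence by at most
   [L] columns and, as [side <= h], by at most [L] places within a column. *)
- set L := Num.truncn (1 + rho / side).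
  have L0 : 0 <= 1 + rho / side by rewrite addr_ge0// divr_ge0// ltW.
  have bd : side + rho <= (1 + rho / side) * side.
    by rewrite mulrDl mul1r divfK// gt_eqF.
  have bd' : side + rho <= (1 + rho / side) * h.
    by rewrite (le_trans bd)// ler_wpM2l.
  have : (#|[set i | meets_square U (c i) side]%SET| <= L.+1 ^ 2)%N.
    apply: card_narrow => -[u1 u2] [v1 v2]; rewrite !finset.in_set => uS vS.
      have [/= H _] := meets_square_close dU uS vS.
      apply: (@close_ord _ _ _ (side + rho) _ s0) bd.
      by move: H; rewrite (_ : X u1 - X v1 = u1%:R * side - v1%:R * side)// /X; lra.
    move=> /= uv; have [/= _ H] := meets_square_close dU uS vS.
    apply: (@close_ord _ _ _ (side + rho) _ h0) bd'.
    move: H; rewrite uv (_ : _ - (Y _ + _) = u2%:R * h - v2%:R * h)//; lra.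
  rewrite -(ler_nat R) => /le_trans; apply; rewrite natrX.
  have := truncn_le (1 + rho / side); rewrite L0 -/L => Lle.
  by rewrite lerXn2r ?nnegrE// -?natr1; lra.
Qed.

End Children.

(** If [a.2 = 0], then [a.1] is non-zero and exchanging the coordinates gives the previous case. *)
Lemma children_exist a p (r : R) (T W : nat) : a != (0, 0) -> 0 < r ->
  (0 < W)%N -> exists c : 'I_(W * T.+1) * 'I_T -> R * R, good_children a p r c.
Proof.
move=> a0 r0 W0; have [b0|b0] := eqVneq a.2 0; last exact: children_nonvertical.
have a10 : a.1 != 0.
  by apply: contra a0 => /eqP a10; rewrite [a]surjective_pairing a10 b0.
have [c [c1 c2 c3]] := @children_nonvertical (swap2 a) (swap2 p) r T W a10 r0 W0.
exists (swap2 \o c); split => [i x [xa xb]|i x [xa xb]|U rho rho0 dU].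
- by have [] := c1 i (swap2 x) (conj xb xa).
- have := c2 i (swap2 x) (conj xb xa).
  rewrite /pivot /= (negbTE a10) b0 eqxx /l1norm /dot /= addrC.
  by rewrite [X in strips _ _ X -> _]addrC b0.
- have dU' : supdiam_le [set x | U (swap2 x)] rho.
    by move=> x y Ux Uy; have [? ?] := dU _ _ Ux Uy.
  have := c3 _ _ rho0 dU'; congr (_ <= _); congr (_%:R).
  apply: eq_card => i; rewrite !finset.in_set; apply/asboolP/asboolP.
    by move=> [x [[? ?] Ux]]; exists (swap2 x).
  move=> [x [[? ?] Ux]]; exists (swap2 x); split => //=.
  by rewrite /swap2 /= -surjective_pairing.
Qed.

End Geometry.

(** * Scales and the averaging step *)

Section Levels.
Variable R : realType.

(** Averaging: if every [c] had a total of at least 1, summing over [c] and exchanging the sums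
    would bound [#|I|] by [#|I|] times the sum of [G], which is smaller than [#|I|]. *)
Lemma exists_small_fiber (I : finType) (f : nat -> I -> R) (G : nat -> R) :
  (forall i c, 0 <= f i c) -> (forall i, 0 <= G i) -> (0 < #|I|)%N ->
  (forall i, \sum_c f i c <= #|I|%:R * G i) ->
  (\sum_(i <oo) (G i)%:E < 1)%E -> exists c, (\sum_(i <oo) (f i c)%:E < 1)%E.
Proof.
move=> f0 G0 I0 fG G1; apply: contrapT => /forallNP H.
have : (\sum_(c : I) 1 <= \sum_(c : I) \sum_(i <oo) (f i c)%:E)%E.
  by apply: lee_sum => c _; rewrite leNgt; apply/negP/H.
rewrite -nneseries_sum; last by move=> *; rewrite lee_fin.
rewrite leNgt => /negP; apply.
apply: (@le_lt_trans _ _ (\sum_(i <oo) (#|I|%:R * (G i))%:E)%E).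
  apply: lee_nneseries => i _.
    by move=> _; apply: sume_ge0 => c _; rewrite lee_fin.
  by rewrite sumEFin lee_fin.
under eq_eseriesr do rewrite EFinM.
rewrite nneseriesZl; last by move=> i _; rewrite lee_fin.
rewrite sumEFin sumr_const -[X in (_ < X%:E)%E]mulr1 EFinM.
by rewrite lte_pmul2l ?lte_fin ?ltr0n.
Qed.

(* Large enough that [columns n] to any fixed positive power eventually exceeds
   [18 * n.+2]; see [columns_powR]. *)
Definition lines (n : nat) : nat := ((18 * n.+2) ^ n.+1)%N.

(** This is [W * T.+1] with [W = n.+1] and [T = lines n]: the side of a child is the spacing of the
    lines divided by [n.+1]. *)
Definition columns (n : nat) : nat := (n.+1 * (lines n).+1)%N.

Fixpoint scale (n : nat) : R :=
  if n is m.+1 then scale m / (columns m)%:R else 1.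

(* The factor [18 * n.+1] is twice the loss [n.+1] of keeping only thin strips
   times the 9 of [(2 + t) ^+ 2 <= 9 * t ^+ 2] for [1 <= t]. *)
Definition frostman (s : R) (n : nat) (rho : R) : R :=
  (18 * n.+1)%:R * (rho / scale n) `^ s.

Lemma columns_gt0 n : (0 < columns n)%N.
Proof. by rewrite muln_gt0. Qed.

Lemma lines_gt0 n : (0 < lines n)%N.
Proof. by rewrite expn_gt0. Qed.

Lemma scale_gt0 n : 0 < scale n.
Proof.
by elim: n => [|n IH] /=; rewrite ?ltr01// divr_gt0// ltr0n columns_gt0.
Qed.

Lemma scaleS_le n : scale n.+1 <= scale n.
Proof.
rewrite /= ler_pdivrMr ?ltr0n ?columns_gt0//.
by rewrite ler_peMr ?ler1n ?columns_gt0// ltW// scale_gt0.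
Qed.

Lemma scale_le1 n : scale n <= 1.
Proof. by elim: n => // n; apply: le_trans (scaleS_le n). Qed.

Lemma scale_le n : scale n <= n.+1%:R^-1.
Proof.
elim: n => [|n IH]; first by rewrite invr1.
rewrite /= -[X in _ <= X]mul1r ler_pM ?invr_ge0 ?scale_le1 ?(ltW (scale_gt0 _))//.
rewrite lef_pV2 ?posrE ?ltr0n ?columns_gt0// ler_nat.
apply: (@leq_trans (n.+1 * 2)).
  by rewrite mulnC mul2n -addnn addSn ltnS addnS ltnS leq_addl.
by rewrite leq_mul2l ltnS lines_gt0 orbT.
Qed.

(** As [columns n] exceeds the power [n.+1] of [18 * n.+2], its power [2 - s] is at least
    [18 * n.+2] once [(2 - s) * n.+1] is at least 1. *)
Lemma columns_powR s n : s < 2 -> 1 <= (2 - s) * n.+1%:R ->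
  (18 * n.+2)%:R * (columns n)%:R `^ s <= (columns n)%:R ^+ 2 :> R.
Proof.
move=> s2 hn.
have P0 : 0 < (columns n)%:R :> R by rewrite ltr0n columns_gt0.
have -> : (columns n)%:R ^+ 2 = (columns n)%:R `^ (2 - s) * (columns n)%:R `^ s :> R.
  rewrite -powRD; last by apply/implyP => _; rewrite gt_eqF.
  by rewrite subrK -powR_mulrn ?ltW.
rewrite ler_pM2r ?powR_gt0//.
have h1 : (1 : R) <= (18 * n.+2)%:R by rewrite ler1n.
have h2 : ((18 * n.+2)%:R `^ n.+1%:R) `^ (2 - s) <= (columns n)%:R `^ (2 - s) :> R.
  rewrite ge0_ler_powR ?nnegrE ?powR_ge0//; first by rewrite subr_ge0 ltW.
  rewrite powR_mulrn ?ler0n// -natrX ler_nat -/(lines n).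
  by rewrite (leq_trans (leqnSn _))// /columns leq_pmull.
rewrite (le_trans _ h2)// -powRrM mulrC.
rewrite -[X in X <= _]powRr1 ?ler0n//.
exact: ler_powR.
Qed.

Lemma frostman_ge1 s n rho : 0 <= s -> scale n <= rho -> 1 <= frostman s n rho.
Proof.
move=> s0 h; rewrite -[1]mulr1 ler_pM//; first by rewrite ler1n.
have r1 : 1 <= rho / scale n by rewrite ler_pdivlMr ?mul1r// scale_gt0.
by rewrite -(powRr0 (rho / scale n)) ler_powR.
Qed.

(** Here [c] counts the children met by a set of size [rho]. Unless the minimum on the right is 1,
    both sides are compared with [9 * columns n ^+ 2] times the [s]-th power of [t = rho / scale n].
    For [rho >= scale n.+1], use [c <= 9 * (rho / scale n.+1) ^+ 2] and [t < 1]; for smaller [rho],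
    use [c <= 9] and [columns_powR]. *)
Lemma frostman_step s n rho c : 0 <= s -> s < 2 -> 1 <= (2 - s) * n.+1%:R ->
  0 < rho -> 0 <= c -> c <= (columns n * lines n)%:R ->
  c <= (2 + rho / scale n.+1) ^+ 2 ->
  c * Num.min 1 (frostman s n.+1 rho) <=
    (columns n * lines n)%:R * Num.min 1 (frostman s n rho).
Proof.
move=> s0 s2 hn rho0 c0 cN cq.
have r0 := scale_gt0 n.
have P0 : 0 < (columns n)%:R :> R by rewrite ltr0n columns_gt0.
have N0 : 0 <= (columns n * lines n)%:R :> R by rewrite ler0n.
have le1 x : Num.min 1 x <= 1 :> R by rewrite ge_min lexx.
have [B1|B1] := leP 1 (frostman s n rho).
  rewrite mulr1 (le_trans _ cN)// -[X in _ <= X]mulr1 ler_wpM2l//.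
have t0 : 0 < rho / scale n by rewrite divr_gt0.
have tP : rho / scale n.+1 = rho / scale n * (columns n)%:R.
  by rewrite /= invf_div mulrA -mulrA [(columns _)%:R * _]mulrC mulrA.
rewrite tP in cq; rewrite /frostman tP in B1 *.
have t1 : rho / scale n < 1.
  rewrite ltr_pdivrMr// mul1r ltNge; apply/negP => h.
  by move: B1; rewrite ltNge (frostman_ge1 s0 h).
set t := rho / scale n in t0 t1 cq tP B1 *.
(* The factor 2 in [18 = 2 * 9] pays for [columns n <= 2 * (n.+1 * lines n)]. *)
have big : 9 * (columns n)%:R ^+ 2 * t `^ s <=
   (columns n * lines n)%:R * ((18 * n.+1)%:R * t `^ s).
  rewrite mulrA ler_wpM2r ?powR_ge0// -natrX -!natrM ler_nat.
  have -> : (columns n * lines n * (18 * n.+1) =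
      9 * (columns n * (2 * (n.+1 * lines n))))%N by ring.
  rewrite -mulnn leq_mul// leq_mul// mulnCA leq_mul2l /=.
  by rewrite mul2n -addnn -addn1 leq_add2l lines_gt0.
apply: le_trans big.
have [h|h] := leP 1 (t * (columns n)%:R).
  rewrite (le_trans (ler_wpM2l c0 (le1 _)))// mulr1 (le_trans cq)//.
  apply: (@le_trans _ _ (9 * (columns n)%:R ^+ 2 * t ^+ 2)).
    rewrite -mulrA -exprMn mulrC -[9](_ : 3 ^+ 2 = _) -?exprMn; last by rewrite -natrX.
    rewrite [t * _]mulrC in h *; rewrite lerXn2r ?nnegrE//; lra.
  rewrite ler_wpM2l ?mulr_ge0 ?exprn_ge0//.
  rewrite -powR_mulrn ?(ltW t0)//.
  by apply: ger_powR; rewrite ?t0 ?ltW.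
have c9 : c <= 9.
  rewrite (le_trans cq)// -[9](_ : 3 ^+ 2 = _); last by rewrite -natrX.
  have tP0 : 0 < t * (columns n)%:R by rewrite mulr_gt0.
  rewrite lerXn2r ?nnegrE//; lra.
rewrite (@le_trans _ _ (9 * ((18 * n.+2)%:R * (t * (columns n)%:R) `^ s)))//.
  by rewrite ler_pM// ?le_min ?ler01 ?mulr_ge0 ?powR_ge0// ge_min lexx orbT.
rewrite powRM ?(ltW t0) ?(ltW P0)//.
have h9 : 0 <= 9 * t `^ s by rewrite mulr_ge0 ?powR_ge0.
by move: (ler_wpM2l h9 (columns_powR s2 hn)); congr (_ <= _); ring.
Qed.

End Levels.

(** * A point of the set outside a thin family *)

Section FalconerSet.
Variables (R : realType) (a : nat -> R * R).
Hypothesis a_neq0 : forall n, a n != (0, 0).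
Implicit Types (p q x : R * R).
Local Notation scale := (scale R).

Definition level_strips (n : nat) : set R :=
  strips (pivot (a n) * (scale n / (lines n).+1%:R)) (l1norm (a n) * scale n.+1).

Definition falconer_set : set (R * R) :=
  [set x | square (0, 0) 1 x /\ forall n, level_strips n (dot (a n) x)].

Definition child (n : nat) p q : Prop :=
  square q (scale n.+1) `<=` square p (scale n) /\
  forall x, square q (scale n.+1) x -> level_strips n (dot (a n) x).

Lemma square_corner p (r : R) : 0 <= r -> square p r p.
Proof. by move=> r0; split; rewrite lexx lerDl. Qed.

(** The coordinates of the corners increase with [n] and never exceed the right end of an earlier
    square, so the pair of their suprema lies in every square. *)
Lemma nested_squares (P : nat -> R * R) :
  (forall n, square (P n.+1) (scale n.+1) `<=` square (P n) (scale n)) ->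
  exists x, forall n, square (P n) (scale n) x.
Proof.
move=> sub.
have subk n k : square (P (n + k)%N) (scale (n + k)) `<=` square (P n) (scale n).
  elim: k => [|k IH]; first by rewrite addn0.
  by rewrite addnS; apply: subset_trans (sub _) IH.
have s0 n : 0 <= scale n by rewrite ltW// scale_gt0.
have key (f : R * R -> R) : (forall p r x, square p r x -> f p <= f x <= f p + r) ->
    (forall p (r : R), 0 <= r -> exists2 x, square p r x & f x = f p + r) ->
    forall n, f (P n) <= sup (range (f \o P)) <= f (P n) + scale n.
  move=> f1 f2 n.
  have ub : ubound (range (f \o P)) (f (P n) + scale n).
    move=> _ [m _ <-] /=; have [mn|nm] := leqP m n.
      have := @subk m (n - m)%N _ (square_corner _ (s0 _)).
      rewrite subnKC// => /f1 /andP[h _].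
      by rewrite (le_trans h)// lerDl.
    have := @subk n (m - n)%N _ (square_corner _ (s0 _)).
    by rewrite subnKC ?(ltnW nm)// => /f1 /andP[].
  apply/andP; split; last by apply: ge_sup => //; exists (f (P 0%N)), 0%N.
  by apply: ub_le_sup; [exists (f (P n) + scale n)|exists n].
have k1 := key fst; have k2 := key snd.
exists (sup (range (fst \o P)), sup (range (snd \o P))) => n; split => /=.
  apply: k1 => [p r x []//|p r r0]; exists (p.1 + r, p.2) => //.
  by split; rewrite /= ?lexx lerDl r0.
apply: k2 => [p r x []//|p r r0]; exists (p.1, p.2 + r) => //.
by split; rewrite /= ?lexx lerDl r0.
Qed.

Lemma nested_children (P : nat -> R * R) : P 0%N = (0, 0) ->
  (forall n, child n (P n) (P n.+1)) ->
  exists2 x, falconer_set x & forall n, square (P n) (scale n) x.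
Proof.
move=> P0 Pc.
have [|x Px] := @nested_squares P; first by move=> n; case: (Pc n).
exists x => //; split; first by rewrite -P0; exact: (Px 0%N).
by move=> n; have [_] := Pc n; apply; exact: Px.
Qed.

Section Avoiding.
Variables (s : R) (U : nat -> set (R * R)) (rho : nat -> R).
Hypotheses (s_ge0 : 0 <= s) (s_lt2 : s < 2).
Hypothesis rho_gt0 : forall i, 0 < rho i.
Hypothesis U_rho : forall i, supdiam_le (U i) (rho i).

(* An upper estimate of the proportion of [falconer_set] in the square that lies
   in [U i]; it is at most 1 and exactly 1 once the square is smaller than
   [rho i], so a square of potential less than 1 avoids all the large [U i]. *)
Definition share (n : nat) p (i : nat) : R :=
  if meets_square (U i) p (scale n) then Num.min 1 (frostman s n (rho i)) else 0.

Definition potential (n : nat) p : \bar R := (\sum_(i <oo) (share n p i)%:E)%E.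

Lemma frostman_ge0 n t : 0 <= frostman s n t.
Proof. by rewrite mulr_ge0// powR_ge0. Qed.

Lemma share_ge0 n p i : 0 <= share n p i.
Proof.
rewrite /share; case: ifP => // _.
by rewrite le_min ler01 frostman_ge0.
Qed.

Lemma exists_child n p : exists q, child n p q.
Proof.
have [c [c1 c2 _]] := children_exist p (lines n) (a_neq0 n) (scale_gt0 R n) (ltn0Sn n).
have i : 'I_(n.+1 * (lines n).+1) * 'I_(lines n).
  by split; [exact: (Ordinal (columns_gt0 n))|exact: (Ordinal (lines_gt0 n))].
by exists (c i); split; [exact: c1|exact: c2].
Qed.

(** Averaging over the children, with [frostman_step] applied to each [U i] and the number of
    children it meets. A [U i] that misses the parent misses all of them. *)
Lemma potential_step n p : 1 <= (2 - s) * n.+1%:R -> (potential n p < 1)%E ->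
  exists2 q, child n p q & (potential n.+1 q < 1)%E.
Proof.
move=> hn Phi.
have [c [c1 c2 c3]] := children_exist p (lines n) (a_neq0 n) (scale_gt0 R n) (ltn0Sn n).
have cardI : #|{: 'I_(n.+1 * (lines n).+1) * 'I_(lines n)}| =
    (columns n * lines n)%N by rewrite card_prod !card_ord.
suff [i Hi] : exists i, (potential n.+1 (c i) < 1)%E.
  by exists (c i) => //; split; [exact: c1|exact: c2].
apply: (@exists_small_fiber _ _ (fun i j => share n.+1 (c j) i) (share n p)).
- by move=> *; exact: share_ge0.
- by move=> *; exact: share_ge0.
- by rewrite cardI muln_gt0 columns_gt0 lines_gt0.
- move=> i; rewrite cardI /share.
  have [m|nm] := boolP (meets_square (U i) p (scale n)); last first.
    rewrite mulr0 big1// => j _; case: ifP => // /asboolP[x [xc Ux]].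
    by case/asboolP: nm; exists x; split => //; exact: c1 xc.
  rewrite -big_mkcond /= sumr_const -[X in X <= _]mulr_natl.
  apply: frostman_step => //.
    by rewrite ler_nat -cardI max_card.
  have := c3 (U i) (rho i) (ltW (rho_gt0 i)) (U_rho (i := i)).
  apply: le_trans; rewrite ler_nat; apply: subset_leq_card.
  by apply/fintype.subsetP => j; rewrite finset.in_set.
- exact: Phi.
Qed.

(** From level [n0] on, children of potential below 1 are chosen. If the limit point were in [U i],
    a late square with [scale n <= rho i] would have share 1, so potential at least 1. *)
Lemma falconer_avoids (n0 : nat) : 1 <= (2 - s) * n0.+1%:R ->
  (\sum_(i <oo) (if U i == set0 then 0 else frostman s n0 (rho i))%:E < 1)%E ->
  exists2 x, falconer_set x & forall i, ~ U i x.
Proof.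
move=> hn0 Phi0.
(* This holds for every square of level [n0], so the choices before [n0] are arbitrary. *)
have base p : (potential n0 p < 1)%E.
  apply: le_lt_trans Phi0; apply: lee_nneseries => i _.
    by move=> _; rewrite lee_fin share_ge0.
  rewrite lee_fin /share; have [/asboolP m|_] := boolP (meets_square _ _ _).
    have -> : (U i == set0) = false.
      by apply/negbTE/set0P; case: m => x [_ Ux]; exists x.
    by rewrite ge_min lexx orbT.
  by case: ifP => // _; exact: frostman_ge0.
pose Inv n p := (n0 <= n)%N -> (potential n p < 1)%E.
have step (np : nat * (R * R)) : exists q, Inv np.1 np.2 ->
    child np.1 np.2 q /\ Inv np.1.+1 q.
  case: np => n p /=; have [nn0|n0n] := leqP n0 n.
    have hn : 1 <= (2 - s) * n.+1%:R.
      by rewrite (le_trans hn0)// ler_wpM2l ?ler_nat// subr_ge0 ltW.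
    have [Ip|Ip] := pselect (Inv n p); last by exists p.
    by have [q qc qP] := potential_step hn (Ip nn0); exists q => _; split.
  have [q qc] := exists_child n p; exists q => _; split => // n0n1.
  by have -> : n.+1 = n0 by apply/eqP; rewrite eqn_leq n0n.
have [f Hf] := choice step.
pose P := fix P n := if n is m.+1 then f (m, P m) else (0, 0) : R * R.
have PInv n : Inv n (P n).
  elim: n => [|n IH]; last by have /= := (Hf (n, P n) IH).2.
  by rewrite /Inv leqn0 => /eqP <-.
have [//|n|x Ex Px] := @nested_children P; first exact: (Hf (n, P n) (PInv n)).1.
exists x => // i Uix.
pose n := maxn n0 (Num.truncn (rho i)^-1).
have sn : scale n <= rho i.
  rewrite (le_trans (scale_le _ _))// -[leRHS]invrK lef_pV2 ?posrE ?invr_gt0//.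
  by rewrite ltW// (lt_le_trans (truncnS_gt _))// ler_nat ltnS leq_maxr.
have := PInv n (leq_maxl _ _); rewrite ltNge => /negP; apply.
have sh1 : share n (P n) i = 1.
  have -> : share n (P n) i = Num.min 1 (frostman s n (rho i)).
    by rewrite /share ifT//; apply/asboolP; exists x; split.
  by apply/eqP; rewrite eq_minl; exact: frostman_ge1.
rewrite /potential (nneseries_split 0%N i.+1); last first.
  by move=> *; rewrite lee_fin share_ge0.
rewrite add0n big_nat_recr//= sh1 -addeA -addeCA -[leLHS]adde0 leeD2l// adde_ge0//.
  by apply: sume_ge0 => *; rewrite lee_fin share_ge0.
by apply: nneseries_ge0 => *; rewrite lee_fin share_ge0.
Qed.

End Avoiding.
End FalconerSet.

(** * Closedness and measure of strips *)

Section Strips.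
Variable R : realType.

Lemma strips_norm (h e : R) : strips h e = strips `|h| e.
Proof.
have [h0|h0] := leP 0 h; first by rewrite ger0_norm.
apply/seteqP; split=> t [k hk]; exists (- k).
  by rewrite (ltr0_norm h0) mulrNz mulrNN.
by move: hk; rewrite (ltr0_norm h0) mulrNz mulNr mulrN.
Qed.

(** The points of the lattice nearest to [p] are its two neighbours. If both are farther than [e],
    so is every lattice point, by a common margin [d], and the ball of radius [d] about [p] misses
    the strips. *)
Lemma closed_strips (h e : R) : h != 0 -> closed (strips h e).
Proof.
move=> h0; rewrite strips_norm; move: h0; rewrite -normr_gt0.
move: `|h| => {}h h0 p clp; apply: contrapT => np.
have far (k : int) : e < `|p - k%:~R * h|.
  by rewrite ltNge; apply/negP => le; apply: np; exists k.
pose k0 := Num.floor (p / h).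
have k0p : k0%:~R * h <= p by rewrite -ler_pdivlMr// floor_le.
have k1p : p <= (k0 + 1)%:~R * h by rewrite -ler_pdivrMr// ltW// floorD1_gt.
pose d := Num.min (`|p - k0%:~R * h|) (`|p - (k0 + 1)%:~R * h|) - e.
have d0 : 0 < d by rewrite subr_gt0 lt_min !far.
have [t [[k kt] /= pt]] := clp _ (nbhsx_ballx p d d0).
have kp : `|p - k%:~R * h| < d + e.
  rewrite (_ : p - _ = (p - t) + (t - k%:~R * h)); last by ring.
  by rewrite (le_lt_trans (ler_normD _ _))// ltr_leD.
rewrite /d subrK lt_min in kp; case/andP: kp.
have [kk0|k0k] := leP k k0.
  have kh : k%:~R * h <= k0%:~R * h by rewrite ler_pM2r// ler_int.
  by rewrite ger0_norm 1?ger0_norm; lra.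
have kh : (k0 + 1)%:~R * h <= k%:~R * h by rewrite ler_pM2r// ler_int lezD1.
by move=> _; rewrite ler0_norm 1?ler0_norm; lra.
Qed.

(** [lebesgue_measure] unfolds to an outer measure defined on all sets, so monotonicity covers
    non-measurable ones as well. *)
Lemma le_lebesgue_measure (A B : set R) : A `<=` B ->
  (lebesgue_measure A <= lebesgue_measure B)%E.
Proof.
move=> AB.
rewrite /lebesgue_measure /lebesgue_stieltjes_measure /measure_extension.
exact: le_mu_ext.
Qed.

(** Only the intervals about [k * h] with [|k| <= (M + e) / h] meet [[-M, M]]; each has length
    [2 * e]. *)
Lemma lebesgue_measure_strips (h e M : R) : 0 < h -> 0 <= e -> 0 <= M ->
  (lebesgue_measure (strips h e `&` [set t | (`|t| <= M)%R]) <=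
     ((2 * ((M + e) / h) + 1) * (2 * e))%:E)%E.
Proof.
move=> h0 e0 M0.
have Me0 : 0 <= (M + e) / h by rewrite divr_ge0 ?addr_ge0// ltW.
pose K := Num.truncn ((M + e) / h).
pose F (j : nat) := `[(j%:R - K%:R) * h - e, (j%:R - K%:R) * h + e]%classic.
have mF j : measurable (F j) by exact: measurable_itv.
apply: (@le_trans _ _ (lebesgue_measure (\big[setU/set0]_(j < K.*2.+1) F j))).
  apply: le_lebesgue_measure => t [[k kt] /= tM].
  have kK : (`|k| <= K)%N.
    rewrite truncn_ge_nat// ler_pdivlMr// -(gtr0_norm h0) natr_absz intr_norm -normrM.
    rewrite (_ : k%:~R * h = t - (t - k%:~R * h)); last by ring.
    by rewrite (le_trans (ler_normB _ _))// lerD// gtr0_norm.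
  have kK0 : 0 <= k + K%:Z.
    by rewrite -lerBlDr sub0r lerNl (le_trans (ler_norm _))// normrN -abszE lez_nat.
  have jK : (`|(k + K%:Z)%R|%N)%:Z = k + K%:Z by rewrite gez0_abs.
  rewrite -bigcup_mkord; exists `|(k + K%:Z)%R|%N => /=.
    by rewrite ltnS -lez_nat jK -addnn PoszD lerD2r (le_trans (ler_norm _))//.
  rewrite /F /= in_itv /= pmulrn jK intrD addrK.
  by move: kt; rewrite ler_distl => /andP[? ?]; apply/andP; split; lra.
apply: (@le_trans _ _ (\sum_(j < K.*2.+1) lebesgue_measure (F j))%E).
  by apply: Boole_inequality => j _; exact: mF.
have -> : (\sum_(j < K.*2.+1) lebesgue_measure (F j) =
    \sum_(j < K.*2.+1) (2 * e)%:E)%E.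
  apply: eq_bigr => j _; rewrite lebesgue_measure_itv/= lte_fin.
  case: ltP => [_|]; first by rewrite -EFinB; congr EFin; ring.
  by move=> le; congr EFin; lra.
rewrite sumEFin lee_fin sumr_const card_ord -[leLHS]mulr_natl ler_wpM2r ?mulr_ge0//.
rewrite -natr1 lerD2r -muln2 natrM mulrC ler_wpM2l//.
by rewrite truncn_le.
Qed.

End Strips.

(** * Compactness of the set *)

Section FalconerCompact.
Variables (R : realType) (a : nat -> R * R).
Hypothesis a_neq0 : forall n, a n != (0, 0).

Lemma pivot_neq0 (b : R * R) : b != (0, 0) -> pivot b != 0.
Proof.
case: b => b1 b2; rewrite /pivot /=; case: (eqVneq b2 0) => // -> b0.
by apply: contra b0 => /eqP ->.
Qed.

Lemma continuous_dot (b : R * R) : continuous (dot b).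
Proof.
move=> x; apply: cvgD; apply: cvgM; by [exact: cvg_cst|exact: cvg_fst|exact: cvg_snd].
Qed.

Lemma compact_falconer_set : compact (falconer_set a).
Proof.
have -> : falconer_set a = (`[0, 1]%classic `*` `[0, 1]%classic) `&`
    \bigcap_n (dot (a n) @^-1` level_strips a n).
  apply/seteqP; split => x.
    move=> [[x1 x2] xs]; split; last by move=> n _; exact: xs.
    by move: x1 x2; rewrite /= !add0r !in_itv.
  move=> [[/= x1 x2] xs]; split; last by move=> n; exact: xs.
  by move: x1 x2; rewrite /square /= !add0r !in_itv.
apply: compact_closedI; first by apply: compact_setX; exact: segment_compact.
apply: closed_bigI => n _; apply: closed_comp => [x _|].
  exact: continuous_dot.
apply: closed_strips; rewrite mulf_neq0// ?pivot_neq0//.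
by rewrite gt_eqF// divr_gt0// scale_gt0.
Qed.

End FalconerCompact.

(** * Polygonal norms *)

Section Norm.
Variables (R : realType) (nX : R * R -> R).
Hypothesis nX_norm : is_norm2 nX.
Implicit Types x y : R * R.

Lemma norm2_ge0 x : 0 <= nX x.
Proof.
case: nX_norm => n0 nZ nD; have := nD x (-1 * x.1, -1 * x.2).
rewrite nZ /= !mulN1r !subrr (n0 _).2// normrN1 mul1r; lra.
Qed.

(* If no constraint with positive bound were tight at [z] with [nX z = 1], then
   [z] could be pushed outwards inside the ball. *)
Lemma norm2_polyhedral : polyhedral2 (unit_ball nX) ->
  exists2 bs : seq (R * R), all (fun b => b != (0, 0)) bs &
    forall x, x <> (0, 0) -> exists2 b, b \in bs & nX x = dot b x.
Proof.
move=> [m [h Bh]]; case: nX_norm => n0 nZ _.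
(* A positive bound is normalised to 1. A zero bound gives [b i = (0, 0)], division by 0 being 0,
   and is filtered out. *)
pose b i : R * R := ((h i).1.1 / (h i).2, (h i).1.2 / (h i).2).
exists [seq b i | i <- enum 'I_m & b i != (0, 0)].
  by apply/allP => _ /mapP[i + ->]; rewrite mem_filter => /andP[].
move=> x x0; pose v := nX x.
have v0 : 0 < v by rewrite lt_neqAle norm2_ge0 andbT eq_sym; apply/eqP => /n0.
pose z : R * R := (v^-1 * x.1, v^-1 * x.2).
have z1 : nX z = 1 by rewrite nZ gtr0_norm ?invr_gt0// mulVf// gt_eqF.
have inB y : unit_ball nX y <-> forall i, dot (h i).1 y <= (h i).2 by rewrite Bh.
have zB : forall i, dot (h i).1 z <= (h i).2 by apply/inB; rewrite /unit_ball /= z1.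
have h2 i : 0 <= (h i).2.
  have : unit_ball nX (0, 0) by rewrite /unit_ball /= (n0 _).2.
  by move=> /inB/(_ i); rewrite /dot /= !mulr0 addr0.
have [i [zi hi]] : exists i, dot (h i).1 z = (h i).2 /\ 0 < (h i).2.
  apply: contrapT => /forallNP H.
  pose good (t : R) := forall i, dot (h i).1 (t * z.1, t * z.2) <= (h i).2.
  have dotZ i t : dot (h i).1 (t * z.1, t * z.2) = t * dot (h i).1 z.
    by rewrite /dot /=; ring.
  have [t t1 gt] : exists2 t, 1 < t & good t.
    (* A constraint with nonpositive value at [z] survives every scaling by [u >= 1]; a slack one
       survives up to the ratio of bound to value. *)
    have step (i : 'I_m) : exists t, 1 < t /\
        forall u, 1 <= u -> u <= t -> dot (h i).1 (u * z.1, u * z.2) <= (h i).2.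
      have [zi0|zi0] := leP (dot (h i).1 z) 0.
        exists 2; split=> [|u u1 _]; first by rewrite ltr1n.
        by rewrite dotZ (le_trans _ (h2 i))// mulr_ge0_le0//; lra.
      have hi0 : 0 < (h i).2 by exact: lt_le_trans zi0 (zB i).
      have zi1 : dot (h i).1 z < (h i).2.
        by rewrite lt_neqAle zB andbT; apply/eqP => e; exact: (H i).
      exists ((h i).2 / dot (h i).1 z); split=> [|u u1 ut].
        by rewrite ltr_pdivlMr// mul1r.
      by rewrite dotZ -ler_pdivlMr.
    have [t Ht] := choice step.
    pose T := \big[Num.min/2]_i t i.
    have T1 : 1 < T.
      rewrite /T; elim/big_ind: _ => [|u w u1 w1|i _]; first by rewrite ltr1n.
        by rewrite lt_min u1.
      by case: (Ht i).
    exists T => // i; apply: (Ht i).2; first exact: ltW.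
    by rewrite /T (bigD1 i)//= ge_min lexx.
  have := (inB (t * z.1, t * z.2)).2 gt; rewrite /unit_ball /mkset (nZ t z) z1 mulr1.
  by rewrite leNgt gtr0_norm ?t1//; lra.
have bx : nX x = dot (b i) x.
  have -> : dot (b i) x = v * (dot (h i).1 z / (h i).2).
    rewrite /dot /b /z /=; field.
    by rewrite !gt_eqF.
  by rewrite zi divff ?gt_eqF// mulr1.
exists (b i) => //; apply/mapP; exists i => //.
rewrite mem_filter mem_enum andbT; apply/eqP => bi0.
by move: v0; rewrite /v bx bi0 /dot /= !mul0r addr0 ltxx.
Qed.

Lemma norm2_le_sup : exists2 C : R, 0 < C &
  forall x t, `|x.1| <= t -> `|x.2| <= t -> nX x <= C * t.
Proof.
case: nX_norm => n0 nZ nD.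
exists (nX (1, 0) + nX (0, 1) + 1) => [|x t x1 x2].
  by rewrite ltr_wpDl// addr_ge0// norm2_ge0.
have t0 : 0 <= t by rewrite (le_trans _ x1).
have := nD (x.1 * 1, x.1 * 0) (x.2 * 0, x.2 * 1).
rewrite (nZ x.1 (1, 0)) (nZ x.2 (0, 1)) /= !mulr1 !mulr0 addr0 add0r.
rewrite -surjective_pairing => /le_trans; apply.
have := ler_wpM2r (norm2_ge0 (1, 0)) x1; have := ler_wpM2r (norm2_ge0 (0, 1)) x2.
by rewrite !mulrDl mul1r; lra.
Qed.

(** Boundedness of the ball, rescaled. It turns the [nX]-diameters of a cover into the radii of
    [supdiam_le]. *)
Lemma sup_le_norm2 : compact (unit_ball nX) -> exists2 M : R, 0 < M &
  forall x, `|x.1| <= M * nX x /\ `|x.2| <= M * nX x.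
Proof.
case: nX_norm => n0 nZ _ /compact_bounded[M0 [_ HM]].
pose M := Num.max (M0 + 1) 1.
have M1 : 0 < M by rewrite lt_max ltr01 orbT.
have MM0 : M0 < M by rewrite lt_max ltrDl ltr01.
exists M => // x; have [->|x0] := eqVneq x (0, 0).
  by rewrite /= normr0 mulr_ge0 ?norm2_ge0 ?ltW.
have v0 : 0 < nX x.
  by rewrite lt_neqAle norm2_ge0 andbT eq_sym; apply: contra x0 => /eqP/n0/eqP.
have : unit_ball nX ((nX x)^-1 * x.1, (nX x)^-1 * x.2).
  by rewrite /unit_ball /= nZ ger0_norm ?invr_ge0 ?norm2_ge0// mulVf ?gt_eqF.
move=> /(HM M MM0); rewrite /= prod_normE /= ge_max => /andP[].
rewrite !normrM ger0_norm ?invr_ge0 ?norm2_ge0//.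
by rewrite ![(nX x)^-1 * _]mulrC !ler_pdivrMr.
Qed.

End Norm.

(** * Hausdorff dimension *)

Section Hausdorff.
Variables (R : realType) (nX : R * R -> R).
Hypothesis nX_norm : is_norm2 nX.

Lemma hweight_ge0 s (U : set (R * R)) : (0 <= hweight nX s U)%E.
Proof. by rewrite /hweight; case: ifP => // _; rewrite lee_fin powR_ge0. Qed.

Lemma hcontent_ge0 s delta E : (0 <= hcontent nX s delta E)%E.
Proof.
apply: le_ereal_inf_tmp => _ [U _ <-]; apply: nneseries_ge0 => i _ _.
exact: hweight_ge0.
Qed.

Lemma hausdorff_measure_ge0 s E : (0 <= hausdorff_measure nX s E)%E.
Proof.
apply: le_trans (hcontent_ge0 s 1 E) _.
by apply: ereal_sup_ubound; exists 1 => //=.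
Qed.

Lemma diamX_le (U : set (R * R)) (t : R) :
  (forall x y, U x -> U y -> nX (psub x y) <= t) -> (diamX nX U <= t%:E)%E.
Proof.
by move=> H; apply: ge_ereal_sup => _ [x Ux [y Uy <-]]; rewrite lee_fin; exact: H.
Qed.

Lemma le_ediamX (U : set (R * R)) x y : U x -> U y ->
  ((nX (psub x y))%:E <= diamX nX U)%E.
Proof. by move=> Ux Uy; apply: ereal_sup_ubound; exists x => //; exists y. Qed.

Lemma diamX_fin_num (U : set (R * R)) (t : R) x : (diamX nX U <= t%:E)%E ->
  U x -> diamX nX U \is a fin_num.
Proof.
move=> dt Ux; have le := le_ediamX Ux Ux; rewrite fin_numE; apply/andP; split.
  by apply/negP => /eqP e; move: le; rewrite e.
by apply/negP => /eqP e; move: dt; rewrite e.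
Qed.

Lemma le_diamX (U : set (R * R)) (t : R) x y : (diamX nX U <= t%:E)%E ->
  U x -> U y -> nX (psub x y) <= fine (diamX nX U).
Proof.
by move=> dt Ux Uy; rewrite -lee_fin fineK ?le_ediamX// (diamX_fin_num dt Ux).
Qed.

Lemma hweight_le (U : set (R * R)) (s t : R) : 0 <= s -> 0 <= t ->
  (diamX nX U <= t%:E)%E -> (hweight nX s U <= (t `^ s)%:E)%E.
Proof.
move=> s0 t0 dt; rewrite /hweight; case: ifPn => [_|/set0P[x Ux]].
  by rewrite lee_fin powR_ge0.
have d0 : 0 <= fine (diamX nX U).
  by rewrite (le_trans (norm2_ge0 nX_norm (psub x x)))// (le_diamX dt).
rewrite lee_fin ge0_ler_powR ?nnegrE// -lee_fin (le_trans _ dt)//.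
by rewrite fineK// (diamX_fin_num dt Ux).
Qed.

Lemma grid_cell (t : R) (N : nat) : (0 < N)%N -> 0 <= t <= 1 ->
  exists2 j : nat, (j < N)%N & j%:R / N%:R <= t <= j%:R / N%:R + N%:R^-1.
Proof.
move=> N0 /andP[t0 t1]; have NR : 0 < N%:R :> R by rewrite ltr0n.
have [t1'|t1'] := ltP t 1; last first.
  exists N.-1; rewrite ?prednK// -[X in _ / _ + X]mul1r -mulrDl natr1 prednK//.
  rewrite divff ?gt_eqF// t1 andbT (le_trans _ t1')// ler_pdivrMr// mul1r.
  by rewrite ler_nat leq_pred.
have tN : 0 <= t * N%:R by rewrite mulr_ge0// ltW.
exists (Num.truncn (t * N%:R)).
  rewrite -(ltr_nat R) (@le_lt_trans _ _ (t * N%:R))//; first by rewrite truncn_le.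
  by rewrite gtr_pMl.
rewrite -[X in _ / _ + X]mul1r -mulrDl natr1 ler_pdivrMr// truncn_le tN.
by rewrite ler_pdivlMr// ltW// truncnS_gt.
Qed.

(** Cutting into [N * N] squares of side [1 / N] gives total weight at most a constant times the
    power [2 - s] of [N], which tends to 0. *)
Lemma hausdorff_measure_square s (E : set (R * R)) : 2 < s ->
  E `<=` square (0, 0) 1 -> hausdorff_measure nX s E = 0%E.
Proof.
move=> s2 Esq; apply/eqP; rewrite eq_le hausdorff_measure_ge0 andbT.
apply: ge_ereal_sup => _ [delta /= d0 <-].
apply/lee_addgt0Pr => eps eps0; rewrite add0e.
have [C C0 HC] := norm2_le_sup nX_norm.
have s0 : 0 < s by lra.
have s20 : 0 < s - 2 by lra.
(* The first term of the maximum makes the diameters at most [delta], the second the total weight at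
   most [eps]. *)
pose N := (Num.truncn (Num.max (C / delta) ((C `^ s / eps) `^ (s - 2)^-1))).+1.
have NR : 0 < N%:R :> R by rewrite ltr0n.
have := truncnS_gt (Num.max (C / delta) ((C `^ s / eps) `^ (s - 2)^-1)).
rewrite -/N gt_max => /andP[/ltW N1 /ltW N2].
have CNd : C / N%:R <= delta.
  by rewrite ler_pdivrMr// mulrC -ler_pdivrMr.
have sum_le : (N * N)%:R * (C / N%:R) `^ s <= eps.
  have : C `^ s / eps <= N%:R `^ (s - 2).
    rewrite -[leLHS]powRr1 ?divr_ge0 ?powR_ge0 ?(ltW eps0)//.
    rewrite -{1}(@mulVf _ (s - 2)) ?gt_eqF// powRrM.
    by rewrite ge0_ler_powR ?nnegrE ?powR_ge0// ltW.
  rewrite ler_pdivrMr// => h.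
  rewrite powRM ?invr_ge0 ?(ltW C0) ?(ltW NR)// -powR_inv1 ?(ltW NR)// -powRrM mulN1r.
  have -> : (N * N)%:R = N%:R `^ 2 :> R by rewrite powR_mulrn ?ler0n// natrM expr2.
  rewrite mulrCA -powRD; last by apply/implyP => _; rewrite gt_eqF.
  rewrite (_ : 2 - s = - (s - 2)); last by ring.
  by rewrite powRN ler_pdivrMr ?powR_gt0// mulrC.
pose U (i : nat) : set (R * R) := if (i < N * N)%N then
  square ((i %/ N)%N%:R / N%:R, (i %% N)%N%:R / N%:R) N%:R^-1 else set0.
have dU i : (diamX nX (U i) <= (C / N%:R)%:E)%E.
  apply: diamX_le => x y; rewrite /U; case: ifP => // _.
  move=> [/= /andP[? ?] /andP[? ?]] [/= /andP[? ?] /andP[? ?]].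
  by apply: HC; rewrite /= ler_norml; apply/andP; split; lra.
apply: (@le_trans _ _ (\sum_(i <oo) hweight nX s (U i))%E).
  apply: ereal_inf_lbound; exists U => //; split; last first.
    by move=> i; rewrite (le_trans (dU i))// lee_fin.
  move=> x /Esq [/=]; rewrite !add0r => /(grid_cell (ltn0Sn _) (N := N))[j jN xj].
  move=> /(grid_cell (ltn0Sn _) (N := N))[l lN xl].
  exists (j * N + l)%N => //; rewrite /U ifT.
    by rewrite divnMDl// divn_small// addn0 modnMDl modn_small.
  by rewrite (@leq_trans (j.+1 * N))// ?leq_mul2r ?jN ?orbT// mulSn addnC ltn_add2r.
rewrite (nneseries_split 0%N (N * N)); last by move=> *; exact: hweight_ge0.
rewrite add0n [X in (_ + X)%E]eseries0 => [|i Ni _]; last first.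
  by rewrite /U ltnNge Ni /hweight eqxx.
rewrite adde0 (@le_trans _ _ (\sum_(0 <= i < N * N) ((C / N%:R) `^ s)%:E)%E)//.
  by apply: lee_sum => i _; apply: hweight_le; rewrite ?divr_ge0 ?(ltW C0) ?(ltW s0).
by rewrite sumEFin lee_fin sumr_const_nat subn0 -[leLHS]mulr_natl.
Qed.

(** Covers may contain single points, whereas [falconer_avoids] wants positive radii. For [s = 0]
    all powers are 1, so any enlargement is free. *)
Lemma enlarge_radius (s d eta : R) : 0 <= s -> 0 <= d -> 0 < eta ->
  exists rho : R, [/\ 0 < rho, d <= rho & rho `^ s <= d `^ s + eta].
Proof.
rewrite le_eqVlt => /predU1P[<-|s0] d0 eta0.
  by exists (d + 1); rewrite !powRr0; split; lra.
have e0 : 0 < eta `^ s^-1 by rewrite powR_gt0.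
exists (Num.max d (eta `^ s^-1)); split; first by rewrite lt_max e0 orbT.
  by rewrite le_max lexx.
have [_|_] := leP d (eta `^ s^-1); last by rewrite lerDl ltW.
by rewrite -powRrM mulVf ?gt_eqF// powRr1 ?(ltW eta0)// lerDr powR_ge0.
Qed.

(** At the fixed level [n0], [frostman] is a constant times the [s]-th power of the radius. A cover
    of weight below [1 / (2 * B)] then has [frostman] sum below [1 / 2 + 1 / 4], the quarter paying
    for enlarged radii, and [falconer_avoids] yields an uncovered point. *)
Lemma hausdorff_measure_falconer (a : nat -> R * R) s :
  compact (unit_ball nX) -> (forall n, a n != (0, 0)) -> 0 <= s -> s < 2 ->
  hausdorff_measure nX s (falconer_set a) <> 0%E.
Proof.
move=> cB a0 s0 s2 H0.
have [M M0 HM] := sup_le_norm2 nX_norm cB.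
pose n0 := Num.truncn (2 - s)^-1.
have hn0 : 1 <= (2 - s) * n0.+1%:R.
  have s20 : 0 < 2 - s by rewrite subr_gt0.
  by rewrite mulrC -ler_pdivrMr// mul1r ltW// truncnS_gt.
have r0 := scale_gt0 R n0.
pose c : R := (18 * n0.+1)%:R * (scale R n0)^-1 `^ s.
have c0 : 0 < c by rewrite mulr_gt0 ?ltr0n// powR_gt0// invr_gt0.
have frE rho : 0 <= rho -> frostman s n0 rho = c * rho `^ s.
  move=> rho0; rewrite /frostman powRM ?invr_ge0 ?(ltW r0)//.
  by rewrite /c -mulrA [X in _ = _ * X]mulrC.
pose B := c * M `^ s.
have B0 : 0 < B by rewrite mulr_gt0// powR_gt0.
have : (hcontent nX s 1 (falconer_set a) < ((2 * B)^-1)%:E)%E.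
  apply: (@le_lt_trans _ _ 0%E); last by rewrite lte_fin invr_gt0 mulr_gt0.
  by rewrite -H0; apply: ereal_sup_ubound; exists 1 => //=.
move=> /ereal_inf_lt[_ [U [cov dU] <-] sumU].
pose D i := fine (diamX nX (U i)).
have HD i : exists rho : R, 0 < rho /\ (U i !=set0 ->
    M * D i <= rho /\ rho `^ s <= (M * D i) `^ s + c^-1 * (4^-1 / (2 ^ i.+1)%:R)).
  have [[x Ux]|U0] := pselect (U i !=set0); last by exists 1.
  have d0 : 0 <= M * D i.
    rewrite mulr_ge0 ?(ltW M0)// (le_trans (norm2_ge0 nX_norm (psub x x)))//.
    exact: (le_diamX (dU i)).
  have e0 : 0 < c^-1 * (4^-1 / (2 ^ i.+1)%:R).
    by rewrite !mulr_gt0 ?invr_gt0// ltr0n expn_gt0.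
  by have [rho [? ? ?]] := enlarge_radius s0 d0 e0; exists rho.
have [rho Hrho] := choice HD.
have rho0 i : 0 < rho i by case: (Hrho i).
have Urho i : supdiam_le (U i) (rho i).
  move=> x y Ux Uy; have [_ /(_ (ex_intro _ x Ux))[h _]] := Hrho i.
  have [h1 h2] := HM (psub x y).
  have h3 : M * nX (psub x y) <= rho i.
    by rewrite (le_trans _ h)// ler_wpM2l ?(ltW M0)// (le_diamX (dU i)).
  by split; [exact: le_trans h1 h3|exact: le_trans h2 h3].
have [|x Ex xU] := falconer_avoids a0 s0 s2 rho0 Urho hn0.
  apply: (@le_lt_trans _ _ (\sum_(i <oo) (B%:E * hweight nX s (U i) +
      (4^-1 / (2 ^ i.+1)%:R)%:E))%E).
    apply: lee_nneseries => i _.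
      by move=> _; rewrite lee_fin; case: ifP => // _; exact: frostman_ge0.
    have e0 : 0 <= 4^-1 / (2 ^ i.+1)%:R :> R by rewrite divr_ge0.
    rewrite /hweight; case: ifPn => [_|/set0P U0].
      by rewrite mule0 add0e lee_fin.
    have [_ h] := (Hrho i).2 U0.
    rewrite -EFinM -EFinD lee_fin frE ?(ltW (rho0 i))//.
    have D0 : 0 <= D i.
      case: U0 => y Uy; rewrite (le_trans (norm2_ge0 nX_norm (psub y y)))//.
      exact: (le_diamX (dU i)).
    have := ler_wpM2l (ltW c0) h.
    by rewrite powRM ?(ltW M0)// mulrDr mulVKf ?gt_eqF// mulrA.
  apply: le_lt_trans (epsilon_trick _ _ _) _.
  - by move=> i; rewrite mule_ge0 ?lee_fin ?(ltW B0)// hweight_ge0.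
  - by rewrite invr_ge0.
  rewrite nneseriesZl; last by move=> i _; exact: hweight_ge0.
  apply: (@lt_le_trans _ _ (B%:E * ((2 * B)^-1)%:E + 4^-1%:E)%E).
    by rewrite lteD2rE// lte_pmul2l.
  rewrite -EFinM -EFinD lee_fin invfM mulrCA mulfV ?gt_eqF// mulr1; lra.
by case: (cov x Ex) => i _ /xU.
Qed.

Lemma hausdorff_dim_falconer (a : nat -> R * R) :
  compact (unit_ball nX) -> (forall n, a n != (0, 0)) ->
  hausdorff_dim nX (falconer_set a) = 2%:E.
Proof.
move=> cB a0; apply/eqP; rewrite eq_le; apply/andP; split.
  apply/lee_addgt0Pr => e e0; apply: ereal_inf_lbound; exists (2 + e) => //.
  split; first by rewrite addr_ge0// ltW.
  by apply: hausdorff_measure_square => [|x []//]; rewrite ltrDl.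
apply: le_ereal_inf_tmp => _ [s [s0 Hs] <-]; rewrite lee_fin leNgt.
by apply/negP => s2; exact: (hausdorff_measure_falconer cB a0 s0 s2) Hs.
Qed.

End Hausdorff.

(** * The distance set *)

Section DistanceSet.
Variable R : realType.

Lemma lebesgue_measure_bigcup0 (F : nat -> set R) :
  (forall n, lebesgue_measure (F n) = 0%E) ->
  lebesgue_measure (\bigcup_n F n) = 0%E.
Proof.
move=> F0; apply/eqP; rewrite eq_le measure_ge0 andbT.
have : (lebesgue_measure (\bigcup_n F n) <= \sum_(n <oo) lebesgue_measure (F n))%E.
  rewrite /lebesgue_measure /lebesgue_stieltjes_measure /measure_extension.
  exact: mu_ext_sigma_subadditive.
by rewrite eseries0.
Qed.

Lemma dot_le_l1norm (b x : R * R) (t : R) : `|x.1| <= t -> `|x.2| <= t ->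
  `|dot b x| <= l1norm b * t.
Proof.
move=> x1 x2; rewrite (le_trans (ler_normD _ _))// !normrM mulrDl.
by rewrite lerD// ler_wpM2l.
Qed.

(** At a level [n] devoted to [b], differences lie within [e] of the lattice of step [h], where
    [e / h] is of order [1 / n.+1]. The measure is thus at most [C / n.+1] for arbitrarily large
    [n]. *)
Lemma dot_differences_null (a : nat -> R * R) (b : R * R) : b != (0, 0) ->
  (forall N, exists2 n, (N <= n)%N & a n = b) ->
  lebesgue_measure [set dot b (psub x y) | x in falconer_set a &
                                           y in falconer_set a] = 0%E.
Proof.
move=> b0 inf; apply/eqP; rewrite eq_le measure_ge0 andbT.
set D := (X in lebesgue_measure X).
apply/lee_addgt0Pr => eps eps0; rewrite add0e.
have p0 : 0 < `|pivot b| by rewrite normr_gt0 pivot_neq0.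
set M := l1norm b; have M0 : 0 <= M by rewrite addr_ge0.
(* From [4 * (M + e) * (e / h) + 2 * e] with [e <= 2 * M / n.+1], so that [M + e <= 3 * M]. *)
pose C := 24 * M ^+ 2 / `|pivot b| + 4 * M.
have C0 : 0 <= C by rewrite addr_ge0 ?mulr_ge0 ?invr_ge0 ?exprn_ge0.
have [n Nn an] := inf (Num.truncn (C / eps)).
have Ceps : C / n.+1%:R <= eps.
  rewrite ler_pdivrMr// mulrC -ler_pdivrMr// ltW// (lt_le_trans (truncnS_gt _))//.
  by rewrite ler_nat.
pose h := `|pivot b| * (scale R n / (lines n).+1%:R).
pose e := 2 * (M * scale R n.+1).
have s0 := scale_gt0 R n.
have h0 : 0 < h by rewrite mulr_gt0// divr_gt0.
have e0 : 0 <= e by rewrite !mulr_ge0// ltW// scale_gt0.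
have eM : e <= 2 * (M / n.+1%:R).
  rewrite ler_wpM2l// ler_wpM2l// (le_trans (scale_le _ _))//.
  by rewrite lef_pV2 ?posrE// ler_nat.
have eh : e / h = 2 * M / (`|pivot b| * n.+1%:R).
  rewrite /e /h /= /columns natrM; field.
  by rewrite !gt_eqF.
have DS : D `<=` strips h e `&` [set t | `|t| <= M].
  move=> _ [x [[x1 x2] xs] [y [[y1 y2] ys] <-]]; split; last first.
    rewrite /= -[M]mulr1; apply: dot_le_l1norm; rewrite /= ler_norml; lra.
  have [k hk] := xs n; have [l hl] := ys n; rewrite an in hk hl.
  have -> : strips h e = strips (pivot b * (scale R n / (lines n).+1%:R)) e.
    rewrite [RHS]strips_norm normrM; congr (strips (_ * _) _).
    by rewrite gtr0_norm// divr_gt0.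
  exists (k - l); rewrite intrB mulrBl.
  have -> : dot b (psub x y) = dot b x - dot b y by rewrite /dot /psub /=; ring.
  move: hk hl; set q := pivot b * _ => hk hl.
  rewrite (_ : _ - _ - _ = (dot b x - k%:~R * q) - (dot b y - l%:~R * q)); last by ring.
  by rewrite (le_trans (ler_normB _ _))// /e mulr2n mulrDl mul1r lerD.
apply: le_trans (le_lebesgue_measure DS) _.
apply: le_trans (lebesgue_measure_strips h0 e0 M0) _; rewrite lee_fin.
apply: le_trans Ceps.
have n1 : M / n.+1%:R <= M by rewrite ler_pdivrMr// ler_peMr// ler1n.
have -> : (2 * ((M + e) / h) + 1) * (2 * e) = 4 * (M + e) * (e / h) + 2 * e.
  by field; rewrite gt_eqF.
have -> : C / n.+1%:R = 12 * M * (e / h) + 4 * (M / n.+1%:R).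
  by rewrite eh /C; field; rewrite !gt_eqF.
move: (M / _) n1 eM => w n1 eM; apply: lerD; last by lra.
by rewrite ler_wpM2r ?divr_ge0 ?(ltW h0)//; lra.
Qed.

End DistanceSet.

Theorem theorem4 (R : realType) (d : nat) (g : 'I_d -> R)
  (nX : R * R -> R) :
  (1 <= d)%N ->
  KM g ->
  is_norm2 nX ->
  sym_convex_polygon (unit_ball nX) (2 * (d + 3)) ->
  injective (prescribed_slope g) ->
  (forall S, is_side (unit_ball nX) S ->
     exists k, side_has_slope (unit_ball nX) S (prescribed_slope g k)) ->
  (forall k, exists S, is_side (unit_ball nX) S /\
     side_has_slope (unit_ball nX) S (prescribed_slope g k)) ->
  exists E : set (R * R),
    [/\ compact E, hausdorff_dim nX E = 2%:E &
        (lebesgue_measure (DeltaX nX E) = 0)%E].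
Proof.
move=> _ _ nX_norm [_ _ cB poly _] _ _ _.
have [bs /allP bs0 nXE] := norm2_polyhedral nX_norm poly.
(* The default [(0, 1)] is a non-zero form, so every index is admissible. *)
pose b i := nth (0, 1) bs i.
have b0 i : b i != (0, 0).
  have [ib|ib] := ltnP i (size bs); first exact/bs0/mem_nth.
  by rewrite /b nth_default// xpair_eqE oner_eq0 andbF.
(* Cycling uses each form infinitely often; the period [(size bs).+1] includes the default form. *)
pose a n := b (n %% (size bs).+1)%N.
have a0 n : a n != (0, 0) by exact: b0.
exists (falconer_set a); split.
- exact: compact_falconer_set.
- exact: hausdorff_dim_falconer.
pose D i := [set dot (b i) (psub x y) | x in falconer_set a & y in falconer_set a].
have D0 i : lebesgue_measure (D i) = 0%E.
  apply: dot_differences_null => // N.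
  have [ib|ib] := leqP i (size bs).
    exists (N * (size bs).+1 + i)%N; last by rewrite /a modnMDl modn_small.
    by rewrite (leq_trans _ (leq_addr _ _))// leq_pmulr.
  exists (N * (size bs).+1 + size bs)%N.
    by rewrite (leq_trans _ (leq_addr _ _))// leq_pmulr.
  by rewrite /a modnMDl modn_small// /b !nth_default// ltnW.
apply/eqP; rewrite eq_le measure_ge0 andbT -(lebesgue_measure_bigcup0 D0).
apply: le_lebesgue_measure => _ [x Ex [y Ey <-]].
(* [nXE] concerns non-zero vectors; the distance 0 is a value of any form, here the one of index
   0. *)
have [e|xy] := pselect (psub x y = (0, 0)).
  exists 0%N => //; exists x => //; exists y => //.
  by rewrite e /dot /= !mulr0 addr0; case: nX_norm => n0 _ _; rewrite (n0 _).2.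
have [c cbs ->] := nXE _ xy.
by exists (index c bs) => //; exists x => //; exists y => //; rewrite /b nth_index.
Qed.
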